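(* Let $u=(u_1,u_2,u_3)$, with $u_i,p:\mathbb{R}^3\times(0,+\infty)\to\mathbb{R}$, and consider the initial value problem $$\begin{cases}u_t+u\nabla u=-\nabla p+\mu\Delta u\\ \operatorname{div}u=0\\ \lim_{t\to0^+}u(x,y,z,t)=h(x,y,z)\end{cases}\qquad \mu>0,\quad (x,y,z,t)\in\mathbb{R}^3\times(0,+\infty),$$ where $h=(h_1,\;c_1h_1+\tilde c_1,\;c_2h_1+\tilde c_2)$ and $h_1(x,y,z)=H(2c_1c_2x-c_2y-c_1z)$, with $c_1,c_2,\tilde c_1,\tilde c_2\in\mathbb{R}$ such that $\tilde c_1c_2+c_1\tilde c_2=0$ and $H$ smooth. Then there exists a smooth solution of this problem, globally defined in $t>0$. In particular, $$u(x,y,z,t)=(u_1,\;c_1u_1+\tilde c_1,\;c_2u_1+\tilde c_2),\qquad p(x,y,z,t)=a(t)(x+c_1y+c_2z)+b(t),$$ where $$u_1(x,y,z,t)=g(2c_1c_2x-c_2y-c_1z,\,t)-A(t)$$ and $$g=g(s,t)=\frac{1}{2\sqrt{\pi\tilde\mu t}}\int_{\mathbb{R}}e^{-\frac{|s-w|^2}{4\tilde\mu t}}H(w)\,dw,\qquad \tilde\mu=\mu(4c_1^2c_2^2+c_1^2+c_2^2),$$ with $A'(t)=a(t)$ and $A(0)=0$.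
   Context: Here $u\nabla u$ denotes the vector with $i$-th component $u_1(u_i)_x+u_2(u_i)_y+u_3(u_i)_z$; $\nabla$, $\Delta$, $\operatorname{div}$ are taken in the space variables $(x,y,z)$. $H$ is a real-valued function on $\mathbb{R}$, and $a,b,A$ are real-valued functions of $t$.
   Formalization: Unless c1=c2=0, the integrand defining g is assumed Lebesgue integrable for all s and t>0 (it diverges e.g. for H(w)=exp(w^4)), also for existence; for c1=c2=0, where the formula for g divides by zero, only existence of a smooth solution is claimed. *)

(* Defs.v *)
From HB Require Import structures.
From mathcomp Require Import all_boot all_order all_algebra.
From mathcomp Require Import all_classical all_reals all_analysis.
Set Implicit Arguments.
Unset Strict Implicit.
Unset Printing Implicit Defensive.
Import Order.TTheory GRing.Theory Num.Theory.
Import numFieldNormedType.Exports.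
Local Open Scope classical_set_scope.
Local Open Scope ring_scope.

(* f is C^oo on the open set U of a finite-dimensional space V: the iterated
   directional derivatives of f of every order, along arbitrary directions,
   exist and are continuous at the points of U. *)
Definition smooth_on (R : realType) (V : normedModType R) (U : set V)
    (f : V -> R) : Prop :=
  forall (vs : seq V) (x : V), U x ->
    let g : V -> R := foldr (fun v k => 'D_v k) f vs in
    {for x, continuous g} /\ forall v : V, derivable g x v.

Definition smooth1_on (R : realType) (I : set R) (f : R -> R) : Prop :=
  @smooth_on R R^o I f.

Section NavierStokes.
Variable R : realType.


Definition positive_time : set ('rV[R]_3 * R) := [set q | 0 < q.2].

Definition dirt : 'rV[R]_3 * R := (0, 1).
Definition dirx (j : 'I_3) : 'rV[R]_3 * R := (delta_mx 0 j, 0).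

Definition comp (u : 'rV[R]_3 * R -> 'rV[R]_3) (i : 'I_3) :
  'rV[R]_3 * R -> R := fun q => u q 0 i.

Definition dt (f : 'rV[R]_3 * R -> R) : 'rV[R]_3 * R -> R := 'D_dirt f.
Definition dx (j : 'I_3) (f : 'rV[R]_3 * R -> R) : 'rV[R]_3 * R -> R :=
  'D_(dirx j) f.

Definition laplacian (f : 'rV[R]_3 * R -> R) (q : 'rV[R]_3 * R) : R :=
  \sum_(j < 3) dx j (dx j f) q.

Definition divergence (u : 'rV[R]_3 * R -> 'rV[R]_3) (q : 'rV[R]_3 * R) : R :=
  \sum_(j < 3) dx j (comp u j) q.

(* i-th component of u nabla u *)
Definition advection (u : 'rV[R]_3 * R -> 'rV[R]_3) (i : 'I_3)
    (q : 'rV[R]_3 * R) : R :=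
  \sum_(j < 3) comp u j q * dx j (comp u i) q.

(* 'D_v has a junk value where the derivative does not exist, hence the
   explicit requirement that every derivative in the equations exists. *)
Definition NS_differentiable (u : 'rV[R]_3 * R -> 'rV[R]_3)
    (p : 'rV[R]_3 * R -> R) (q : 'rV[R]_3 * R) : Prop :=
  (forall i : 'I_3, derivable (comp u i) q dirt) /\
  (forall i j : 'I_3, derivable (comp u i) q (dirx j) /\
                      derivable (dx j (comp u i)) q (dirx j)) /\
  (forall j : 'I_3, derivable p q (dirx j)).

Definition NS_solution (mu : R) (h : 'rV[R]_3 -> 'rV[R]_3)
    (u : 'rV[R]_3 * R -> 'rV[R]_3) (p : 'rV[R]_3 * R -> R) : Prop :=
  [/\ forall q, positive_time q -> NS_differentiable u p q,
      forall q, positive_time q -> forall i : 'I_3,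
        dt (comp u i) q + advection u i q =
        - dx i p q + mu * laplacian (comp u i) q,
      forall q, positive_time q -> divergence u q = 0 &
      forall x : 'rV[R]_3, u (x, t) @[t --> 0^'+] --> h x].

Definition smooth_velocity (u : 'rV[R]_3 * R -> 'rV[R]_3) : Prop :=
  forall i : 'I_3, smooth_on positive_time (comp u i).

Definition smooth_pressure (p : 'rV[R]_3 * R -> R) : Prop :=
  smooth_on positive_time p.

Definition vec3 (a b c : R) : 'rV[R]_3 := \row_(i < 3) [:: a; b; c]`_i.

Definition phase (c1 c2 : R) (x : 'rV[R]_3) : R :=
  2 * c1 * c2 * x 0 0 - c2 * x 0 1 - c1 * x 0 2.

Definition heat_integrand (k : R) (H : R -> R) (s t w : R) : R :=
  expR (- (`|s - w| ^+ 2 / (4 * k * t))) * H w.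

Definition heat_integral (k : R) (H : R -> R) (s t : R) : R :=
  (2 * Num.sqrt (pi * k * t))^-1 *
  \int[@lebesgue_measure R]_w heat_integrand k H s t w.

End NavierStokes.

(* Main.v *)
Require Import Defs.
From HB Require Import structures.
From mathcomp Require Import all_boot all_order all_algebra.
From mathcomp Require Import all_classical all_reals all_analysis.
From mathcomp Require Import measurable_realfun ring lra.
Set Implicit Arguments.
Unset Strict Implicit.
Unset Printing Implicit Defensive.
Import Order.TTheory GRing.Theory Num.Theory.
Import numFieldNormedType.Exports.
Local Open Scope classical_set_scope.
Local Open Scope ring_scope.

(* Write u = u1 e + e0 with e = (1, c1, c2) and e0 = (0, d1, d2), where u1
   depends on x only through the phase.  The gradient l of the phase is
   orthogonal to e, and to e0 by the hypothesis on d1, d2; hence the advection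
   term and the divergence vanish, and the system reduces to
   u1_t + a = mu |l|^2 u1_ss, i.e. to the one-dimensional heat equation
   for g = u1 + A.
   Expanding (s - w)^2, with b = 1 / (4 k t), the heat integral is
   C t^(-1/2) exp(- b s^2) M_0(2 b s, b), where
   M_n(a, b) is the integral of w^n exp(a w - b w^2) H(w).  The moments M_n
   are Frechet differentiable for b > 0, with dM_n = M_{n+1} da - M_{n+2} db, so
   that smoothness and the heat equation become algebra on the moments. *)

(** * Exponential estimates and a criterion for differentiability *)

Section Analysis.
Variable R : realType.

(** Both signs of [y] follow from [1 + y <= expR y], used at [y] and at [- y]. The bound is global
    in [y], as domination under an integral requires. *)
Lemma expR_taylor1_le (y : R) : `|expR y - 1 - y| <= y ^+ 2 * expR `|y|.
Proof.
have h1 := expR_ge1Dx y; rewrite ger0_norm; last lra.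
have h2 : expR y * (1 - y) <= 1.
  by rewrite -[leRHS](expRxMexpNx_1 y) ler_pM2l ?expR_gt0//; have := expR_ge1Dx (- y); lra.
have [y0|y0] := ger0P y.
  have : 0 <= y * (y * expR y - (expR y - 1)) by apply: mulr_ge0; lra.
  nra.
have e1 : 1 <= expR (- y) by have := expR_ge1Dx (- y); lra.
have : 0 <= (- y) * (expR y - 1 - y) by apply: mulr_ge0; lra.
have : 0 <= y ^+ 2 * (expR (- y) - 1) by apply: mulr_ge0; [exact: sqr_ge0|lra].
nra.
Qed.

Lemma expr_le_expR (n : nat) (x : R) : `|x| ^+ n <= expR (n%:R * `|x|).
Proof.
rewrite expRM_natl lerXn2r ?nnegrE ?expR_ge0//.
by have := expR_ge1Dx `|x|; lra.
Qed.

(** Completing the square: half of the quadratic term absorbs the linear one. *)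
Lemma linear_sub_sqr_le (M m x : R) : 0 < m ->
  M * x - m * x ^+ 2 <= M ^+ 2 / (2 * m) - (m / 2) * x ^+ 2.
Proof.
move=> m0; rewrite -subr_ge0.
have -> : M ^+ 2 / (2 * m) - m / 2 * x ^+ 2 - (M * x - m * x ^+ 2) =
  (M - m * x) ^+ 2 / (2 * m) by field; lra.
by apply: divr_ge0; [exact: sqr_ge0|lra].
Qed.

(** A quadratic remainder on a ball is negligible against [h], and uniqueness of the differential
    identifies it. *)
Lemma is_diff_quadratic (V : normedModType R) (f : V -> R) (df : {linear V -> R})
    (x : V) (C d : R) : continuous df -> 0 < d ->
  (forall h, `|h| < d -> `|f (h + x) - f x - df h| <= C * `|h| ^+ 2) ->
  is_diff x f df.
Proof.
move=> cdf d0 Hq.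
have E : f \o shift x = cst (f x) + df +o_ 0 id.
  apply/eqaddoP => _/posnumP[e]; near=> h => /=.
  rewrite -[X in `|X|]/(f (h + x) - (f x + df h)) opprD addrA.
  have hd : `|h| < d.
    near: h; apply/nbhs_ballP; exists d => //= y.
    by rewrite -ball_normE /= sub0r normrN.
  apply: (le_trans (Hq _ hd)).
  rewrite expr2 mulrA ler_wpM2r//.
  (* [C] may be zero or negative, so the radius is taken relative to its absolute value plus 1. *)
  have C1 : 0 < `|C| + 1 by have := normr_ge0 C; lra.
  have : `|h| < e%:num / (`|C| + 1).
    near: h; apply/nbhs_ballP; exists (e%:num / (`|C| + 1)) => /=.
      by apply: divr_gt0.
    by move=> y; rewrite -ball_normE /= sub0r normrN.
  rewrite ltr_pdivlMr// => He.
  have := ler_norm C; have := normr_ge0 h.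
  nra.
have D := diff_unique cdf E.
apply: DiffDef => //.
by apply/diff_locallyP; rewrite D; split.
Unshelve. all: by end_near.
Qed.

End Analysis.

(** * Gaussian moments of [H] and their differentials *)

Section Moments.
Variables (R : realType) (H : R -> R).
Local Notation leb := (@lebesgue_measure R).
Hypothesis mH : measurable_fun setT H.
Hypothesis iH : forall m : R, 0 < m ->
  leb.-integrable setT (EFin \o (fun w => expR (- (m * w ^+ 2)) * H w)).

Lemma le_integrableT (f g : R -> R) : measurable_fun setT f ->
  leb.-integrable setT (EFin \o g) -> (forall w, `|f w| <= `|g w|) ->
  leb.-integrable setT (EFin \o f).
Proof.
move=> mf ig fg; apply: le_integrable ig => //.
  exact/measurable_EFinP.
by move=> x _ /=; rewrite lee_fin.
Qed.

(** Common majorant of all [moment_integrand n a b] with [a] at most [M] in absolute value and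
    [b >= m]. *)
Definition envelope (n : nat) (M m : R) (w : R) : R :=
  `|w| ^+ n * expR (M * `|w| - m * w ^+ 2) * `|H w|.

Lemma envelope_ge0 n M m w : 0 <= envelope n M m w.
Proof. by rewrite /envelope !mulr_ge0 ?exprn_ge0 ?expR_ge0. Qed.

Lemma measurable_gaussian_weight (f : R -> R) :
  continuous f -> measurable_fun setT (fun w => f w * H w).
Proof. by move=> cf; apply: measurable_funM => //; exact: continuous_measurable_fun. Qed.

(** The power of [w] is bounded by an exponential, and half of the decay [m] pays for all linear
    terms, leaving a multiple of the integrand of [iH] at [m / 2]. *)
Lemma integrable_envelope n M m : 0 < m ->
  leb.-integrable setT (EFin \o envelope n M m).
Proof.
move=> m0; have m20 : 0 < m / 2 by lra.
pose C := expR ((n%:R + M) ^+ 2 / (2 * m)).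
apply: (@le_integrableT _ (fun w => C * (expR (- (m / 2 * w ^+ 2)) * H w))).
- apply: measurable_funM; last exact: measurableT_comp.
  apply: continuous_measurable_fun => w.
  apply: cvgM.
    apply: (@cvg_comp _ _ _ (fun x : R => `|x|) (fun x => x ^+ n)).
      exact: (@norm_continuous R R w).
    exact: exprn_continuous.
  apply: (@cvg_comp _ _ _ (fun x : R => M * `|x| - m * x ^+ 2) expR); last exact: continuous_expR.
  apply: cvgB; apply: cvgM; (try exact: cvg_cst).
    exact: (@norm_continuous R R w).
  exact: exprn_continuous.
- have := integrableZl measurableT C (iH m20).
  by under eq_fun do rewrite /= -EFinM.
- move=> w; rewrite [X in X <= _]ger0_norm ?envelope_ge0// normrM (ger0_norm (expR_ge0 _)).
  rewrite normrM (ger0_norm (expR_ge0 _)) mulrA.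
  rewrite /envelope ler_wpM2r// -expRD.
  apply: (@le_trans _ _ (expR (n%:R * `|w|) * expR (M * `|w| - m * w ^+ 2))).
    by rewrite ler_wpM2r ?expR_ge0// expr_le_expR.
  rewrite -expRD ler_expR.
  have := linear_sub_sqr_le (n%:R + M) `|w| m0.
  by rewrite (real_normK (num_real w)); lra.
Qed.

Definition moment_integrand (n : nat) (a b : R) (w : R) : R :=
  w ^+ n * expR (a * w - b * w ^+ 2) * H w.

Definition moment (n : nat) (a b : R) : R :=
  \int[leb]_w moment_integrand n a b w.

Lemma measurable_moment_integrand n a b :
  measurable_fun setT (moment_integrand n a b).
Proof.
apply: measurable_gaussian_weight => w.
apply: cvgM; first exact: exprn_continuous.
apply: (@cvg_comp _ _ _ (fun x : R => a * x - b * x ^+ 2) expR); last exact: continuous_expR.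
by apply: cvgB; apply: cvgM; (try exact: cvg_cst); [exact: cvg_id|exact: exprn_continuous].
Qed.

Lemma integrable_moment_integrand n a b : 0 < b ->
  leb.-integrable setT (EFin \o moment_integrand n a b).
Proof.
move=> b0; apply: le_integrableT (integrable_envelope n `|a| b0) _.
  exact: measurable_moment_integrand.
move=> w; rewrite [leRHS]ger0_norm ?envelope_ge0//.
rewrite /moment_integrand /envelope !normrM normrX (ger0_norm (expR_ge0 _)).
rewrite ler_wpM2r// ler_wpM2l ?exprn_ge0// ler_expR lerD2r.
by rewrite -normrM ler_norm.
Qed.

(** The remainder is exactly the integrand times [expR y - 1 - y] with [y = h * w - k * w ^+ 2], so
    the Taylor bound applies. The restrictions on [h] and [k] make the majorant independent of both,
    apart from the factor [h ^+ 2 + k ^+ 2]. *)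
Lemma moment_integrand_increment n a b h k w : 0 < b ->
  `|h| <= 1 -> `|k| <= b / 2 ->
  `|moment_integrand n (h + a) (k + b) w - moment_integrand n a b w
    - (h * moment_integrand n.+1 a b w - k * moment_integrand n.+2 a b w)|
  <= (2 * (h ^+ 2 + k ^+ 2)) *
     (envelope n.+2 (`|a| + 1) (b / 2) w + envelope n.+4 (`|a| + 1) (b / 2) w).
Proof.
move=> b0 h1 kb.
set y := h * w - k * w ^+ 2.
have -> : moment_integrand n (h + a) (k + b) w - moment_integrand n a b w
    - (h * moment_integrand n.+1 a b w - k * moment_integrand n.+2 a b w) =
    moment_integrand n a b w * (expR y - 1 - y).
  rewrite /moment_integrand /y.
  have -> : (h + a) * w - (k + b) * w ^+ 2 = (a * w - b * w ^+ 2) + (h * w - k * w ^+ 2) by ring.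
  by rewrite expRD !exprS; ring.
rewrite normrM.
have ey := expR_taylor1_le y.
apply: (le_trans (ler_wpM2l (normr_ge0 _) ey)).
rewrite /moment_integrand /envelope !normrM normrX (ger0_norm (expR_ge0 _)).
set N := `|w| ^+ n.
(* The difference of the two sides is a sum of squares. *)
have y2 : y ^+ 2 <= 2 * (h ^+ 2 + k ^+ 2) * (`|w| ^+ 2 + `|w| ^+ 4).
  rewrite -[4%N]/(2 * 2)%N exprM (real_normK (num_real w)) /y.
  rewrite -subr_ge0.
  have -> : 2 * (h ^+ 2 + k ^+ 2) * (w ^+ 2 + (w ^+ 2) ^+ 2) - (h * w - k * w ^+ 2) ^+ 2
    = (h * w + k * w ^+ 2) ^+ 2 + 2 * (h * w ^+ 2) ^+ 2 + 2 * (k * w) ^+ 2 by ring.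
  have := sqr_ge0 (h * w + k * w ^+ 2).
  have := sqr_ge0 (h * w ^+ 2); have := sqr_ge0 (k * w).
  by lra.
(* The exponential of the absolute value of [y] costs at most 1 in the linear coefficient and half
   of the Gaussian decay. *)
have E : expR (a * w - b * w ^+ 2) * expR `|y| <= expR ((`|a| + 1) * `|w| - b / 2 * w ^+ 2).
  rewrite -expRD ler_expR.
  have ya : `|y| <= `|w| + b / 2 * w ^+ 2.
    rewrite /y; apply: (le_trans (ler_normB _ _)).
    rewrite [`|h * w|]normrM [`|k * _|]normrM (ger0_norm (sqr_ge0 w)); apply: lerD.
      by rewrite ler_piMl.
    by rewrite ler_wpM2r ?sqr_ge0.
  have : a * w <= `|a| * `|w| by rewrite -normrM ler_norm.
  by lra.
apply: (@le_trans _ _ (N * `|H w| * ((2 * (h ^+ 2 + k ^+ 2) * (`|w| ^+ 2 + `|w| ^+ 4)) * 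
   expR ((`|a| + 1) * `|w| - b / 2 * w ^+ 2)))).
  rewrite [leLHS](_ : _ = N * `|H w| * (y ^+ 2 * (expR (a * w - b * w ^+ 2) * expR `|y|))); last by ring.
  rewrite ler_wpM2l ?mulr_ge0 ?exprn_ge0//.
  by apply: ler_pM => //; rewrite ?sqr_ge0 ?mulr_ge0 ?expR_ge0.
rewrite -/N le_eqVlt; apply/orP; left; apply/eqP.
by rewrite !exprS -/N; ring.
Qed.

(** Differentiation under the integral: integrating the bound on the increment leaves a remainder
    quadratic in [(h, k)]. *)
Lemma is_diff_moment n (p : R * R) : 0 < p.2 ->
  is_diff p (fun q : R * R => moment n q.1 q.2)
    (fun q => q.1 * moment n.+1 p.1 p.2 - q.2 * moment n.+2 p.1 p.2).
Proof.
case: p => a b /= b0.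
set m1 := moment n.+1 a b; set m2 := moment n.+2 a b.
have lin : linear (fun q : R * R => q.1 * m1 - q.2 * m2).
  by move=> c u v /=; rewrite /GRing.scale /=; ring.
pose dfM := GRing.isLinear.Build _ _ _ _ _ lin.
pose df : {linear (R * R)%type -> R} := HB.pack (fun q : R * R => q.1 * m1 - q.2 * m2) dfM.
rewrite -[X in is_diff _ _ X]/(df : R * R -> R).
have b20 : 0 < b / 2 by lra.
pose E w := envelope n.+2 (`|a| + 1) (b / 2) w + envelope n.+4 (`|a| + 1) (b / 2) w.
have iE : leb.-integrable setT (EFin \o E).
  rewrite (_ : _ \o E = (EFin \o envelope n.+2 (`|a| + 1) (b / 2)) \+
    (EFin \o envelope n.+4 (`|a| + 1) (b / 2)))//.
  by apply: integrableD => //; exact: integrable_envelope.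
(* The factor 2 becomes 4 because [h ^+ 2 + k ^+ 2] is at most twice the square of the maximum norm.
   Within the radius the increment bound applies and [k + b] stays positive. *)
apply: (@is_diff_quadratic _ _ _ df _ (4 * \int[leb]_w E w) (Num.min 1 (b / 2))).
- move=> q; apply: cvgB; apply: cvgM; (try exact: cvg_cst).
    exact: cvg_fst.
  exact: cvg_snd.
- by rewrite lt_min ltr01.
case=> h k hk.
have hle : `|h| <= `|(h, k)| by rewrite [X in _ <= X]prod_normE /= le_max lexx.
have kle : `|k| <= `|(h, k)| by rewrite [X in _ <= X]prod_normE /= le_max lexx orbT.
move: hk; rewrite lt_min => /andP[hk1 hk2].
rewrite /=.
have kb : `|k| <= b / 2 by apply: (le_trans kle); exact: ltW.
have kb0 : 0 < k + b by move: kb; rewrite ler_norml => /andP[]; lra.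
have h1 : `|h| <= 1 by apply: (le_trans hle); exact: ltW.
have I1 := integrable_moment_integrand n (h + a) kb0.
have I2 := integrable_moment_integrand n a b0.
have I3 := integrable_moment_integrand n.+1 a b0.
have I4 := integrable_moment_integrand n.+2 a b0.
have Z (c : R) (f : R -> R) : leb.-integrable setT (EFin \o f) ->
    leb.-integrable setT (EFin \o (fun w => c * f w)).
  move=> If; have := integrableZl measurableT c If.
  by under eq_fun do rewrite /= -EFinM.
have B (f g : R -> R) : leb.-integrable setT (EFin \o f) ->
    leb.-integrable setT (EFin \o g) -> leb.-integrable setT (EFin \o (fun w => f w - g w)).
  by move=> If Ig; have := integrableB measurableT If Ig.
have -> : moment n (h + a) (k + b) - moment n a b - (h * m1 - k * m2) =
  \int[leb]_w (moment_integrand n (h + a) (k + b) w - moment_integrand n a b w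
    - (h * moment_integrand n.+1 a b w - k * moment_integrand n.+2 a b w)).
  rewrite RintegralB//; [|exact: B|by apply: B; exact: Z].
  rewrite [in RHS]RintegralB//.
  rewrite [X in _ = _ - X]RintegralB//; [|exact: Z|exact: Z].
  by rewrite !RintegralZl.
have ID := B _ _ (B _ _ I1 I2) (B _ _ (Z h _ I3) (Z k _ I4)).
apply: (le_trans (le_normr_Rintegral measurableT ID)).
apply: (@le_trans _ _ (\int[leb]_w ((2 * (h ^+ 2 + k ^+ 2)) * E w))).
  apply: le_Rintegral => //.
  - exact: integrable_norm ID.
  - exact: Z.
  - by move=> w _; exact: moment_integrand_increment.
rewrite RintegralZl//.
rewrite [leLHS](_ : _ = (2 * \int[leb]_w E w) * (h ^+ 2 + k ^+ 2)); last by ring.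
rewrite [leRHS](_ : _ = (2 * \int[leb]_w E w) * (`|(h, k)| ^+ 2 + `|(h, k)| ^+ 2)); last by ring.
apply: ler_wpM2l.
  by rewrite mulr_ge0// Rintegral_ge0// => w _; rewrite addr_ge0 ?envelope_ge0.
apply: lerD.
  by rewrite -(real_normK (num_real h)) lerXn2r ?nnegrE.
by rewrite -(real_normK (num_real k)) lerXn2r ?nnegrE.
Qed.

End Moments.

(** * Smoothness from classes closed under differentiation *)

Section SmoothFunctions.
Variable R : realType.

Lemma is_diff_comp1 (V : normedModType R) (phi : R -> R) (f df : V -> R) (x : V) (d : R) :
  is_derive (f x) 1 phi d -> is_diff x f df -> is_diff x (phi \o f) (fun v => df v * d).
Proof.
move=> [phi1 phid] fx.
have dphi : differentiable phi (f x) by apply/derivable1_diffP.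
have Hphi : is_diff (f x) phi (fun h : R => h * d).
  apply: DiffDef => //; rewrite diff1E//; apply/funext => h.
  by rewrite derive1E phid.
exact: is_diff_comp.
Qed.

(** [g] is [f] plus a difference vanishing near [x]; the quadratic criterion with constant 0 gives
    that difference the differential 0. *)
Lemma near_eq_is_diff (V : normedModType R) (f g df : V -> R) (x : V) :
  {near x, f =1 g} -> is_diff x f df -> is_diff x g df.
Proof.
move=> /nbhs_ballP[d /= d0 fg] Df.
have fgx : f x = g x by apply: fg; exact: ballxx.
have D0 : is_diff x (fun q => g q - f q) (\0 : {linear V -> R}).
  apply: (@is_diff_quadratic _ _ _ _ _ 0 d) => //; first exact: cst_continuous.
  move=> h hd; rewrite -fgx /= -(fg (h + x)) ?subrr ?subr0 ?normr0 ?mul0r//.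
  by rewrite -ball_normE /= opprD addrCA subrr addr0 normrN.
have := is_diffD Df D0.
have -> : (f + (fun q => g q - f q) = g)%R by apply/funext => q /=; rewrite fctE; lra.
by move=> D; apply: is_diff_eq; apply/funext => q; rewrite /= fctE addr0.
Qed.

(** Induction on the directions: every iterated derivative agrees on [U] with a member of [E]. As
    [U] is open, the agreement holds near each of its points and passes to the next derivative. *)
Lemma smooth_on_class (V : normedModType R) (U : set V)
    (E : (V -> R) -> Prop) : open U ->
  (forall f, E f -> exists2 f' : V -> V -> R, forall v, E (f' v) &
     forall x, U x -> is_diff x f (fun v => f' v x)) ->
  forall f, E f -> smooth_on U f.
Proof.
move=> oU EP f Ef vs x Ux k.
have [g Eg gf] : exists2 g, E g & forall y, U y -> k y = g y.
  rewrite {}/k; elim: vs => [|v vs [g Eg gf]]; first by exists f.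
  have [g' Eg' gg'] := EP g Eg.
  exists (g' v) => // y Uy /=.
  rewrite (@near_eq_derive _ _ _ _ g y v).
    have D := gg' _ Uy; rewrite deriveE; last exact: ex_diff.
    by rewrite diff_val.
  by near=> z; apply: gf; near: z; exact: open_nbhs_nbhs.
have [g' _ gg'] := EP g Eg.
have dg : differentiable g x by have D := gg' _ Ux; exact: ex_diff.
have nfg : {near x, k =1 g}.
  by near=> z; apply: gf; near: z; exact: open_nbhs_nbhs.
split.
  rewrite /= -/k; change (k @ x --> k x); rewrite (gf _ Ux).
  apply: (@cvg_trans _ (g @ x)); last exact: differentiable_continuous.
  apply: near_eq_cvg.
  by apply: filterS nfg => y ->.
move=> v.
apply: (@near_eq_derivable _ _ _ g) => //.
  by apply: filterS nfg => y ->.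
exact: diff_derivable.
Unshelve. all: by end_near.
Qed.

Lemma smooth1_on_is_derive (I : set R) (f : R -> R) (t : R) :
  smooth1_on I f -> I t -> is_derive t 1 f ('D_1 f t).
Proof. by move=> sf It; apply: derivableP; have [_ /(_ 1)] := sf [::] t It. Qed.

Lemma smooth1_on_continuous (f : R -> R) : smooth1_on setT f -> continuous f.
Proof. by move=> sf x; have [] := sf [::] x I. Qed.

Lemma smooth1_on_derive (I : set R) (f : R -> R) :
  smooth1_on I f -> smooth1_on I ('D_1 f).
Proof. by move=> sf vs t It; have := sf (rcons vs 1) t It; rewrite foldr_rcons. Qed.

End SmoothFunctions.

(** * A class of smooth functions built on the moments *)

Section SmoothClass.
Variables (R : realType) (H : R -> R).
Local Notation leb := (@lebesgue_measure R).
Hypothesis mH : measurable_fun setT H.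
Hypothesis iH : forall m : R, 0 < m ->
  leb.-integrable setT (EFin \o (fun w => expR (- (m * w ^+ 2)) * H w)).
Variables (V : normedModType R) (tau : {linear V -> R}).
Hypothesis ctau : continuous tau.
Let U : set V := [set q | 0 < tau q].

(* Closed under directional derivatives up to equality on [U], and therefore
   made of smooth functions; [heat_class_primitive] is what puts the function
   [A] of the theorem in the class when only its derivative is known to be
   smooth. *)
Inductive heat_class : (V -> R) -> Prop :=
| heat_class_cst c : heat_class (cst c)
| heat_class_lin (l : {linear V -> R}) : continuous l -> heat_class l
| heat_class_isqrt : heat_class (fun q => (Num.sqrt (tau q))^-1)
| heat_class_smooth phi : smooth1_on [set t | 0 < t] phi ->
    heat_class (phi \o tau)
| heat_class_primitive (phi phi' : R -> R) : (forall t : R, 0 < t -> is_derive t 1 phi (phi' t)) ->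
    smooth1_on [set t | 0 < t] phi' -> heat_class (phi \o tau)
| heat_class_add f g : heat_class f -> heat_class g -> heat_class (fun q => f q + g q)
| heat_class_mul f g : heat_class f -> heat_class g -> heat_class (fun q => f q * g q)
| heat_class_exp f : heat_class f -> heat_class (fun q => expR (f q))
| heat_class_moment n f g : heat_class f -> heat_class g ->
    (forall q, U q -> 0 < g q) -> heat_class (fun q => moment H n (f q) (g q))
| heat_class_ext f g : heat_class f -> {in U, f =1 g} -> heat_class g.

Lemma open_heat_domain : open U.
Proof.
have -> : U = tau @^-1` [set t | 0 < t] by [].
by move/continuousP: ctau; apply; exact: open_gt.
Qed.

Lemma is_diff_continuous_linear (l : {linear V -> R}) (x : V) :
  continuous l -> is_diff x l l.
Proof.
by move=> cl; apply: DiffDef; [exact: linear_differentiable|exact: diff_lin].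
Qed.

Lemma is_diff_isqrt (x : V) : U x ->
  is_diff x (fun q => (Num.sqrt (tau q))^-1)
    (fun v => tau v * (- 2^-1 * (Num.sqrt (tau x))^-1 ^+ 3)).
Proof.
move=> Ux; have s0 : Num.sqrt (tau x) != 0 by rewrite gt_eqF// sqrtr_gt0.
have D0 := is_diff_continuous_linear x ctau.
have D1 := is_derive1_sqrt Ux.
have D2 : is_derive (tau x) 1 (fun t => (Num.sqrt t)^-1)
    (- 2^-1 * (Num.sqrt (tau x))^-1 ^+ 3).
  have := is_deriveV s0 D1 => D; apply: is_derive_eq.
  by rewrite /GRing.scale /=; field.
exact: (is_diff_comp1 D2 D0).
Qed.

(** Each generator differentiates into the class: a primitive yields its smooth derivative, and a
    moment of order [n] yields those of orders [n + 1] and [n + 2]. *)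
Lemma heat_class_diff (f : V -> R) : heat_class f ->
  exists2 f' : V -> V -> R, forall v, heat_class (f' v) &
    forall x, U x -> is_diff x f (fun v => f' v x).
Proof.
elim=> {f} [c|l cl||phi sphi|phi phi' dphi sphi'|f g _ [f' Ef' Df'] _ [g' Eg' Dg']
  |f g Ef [f' Ef' Df'] Eg [g' Eg' Dg']|f Ef [f' Ef' Df']
  |n f g Ef [f' Ef' Df'] Eg [g' Eg' Dg'] gpos|f g Ef [f' Ef' Df'] fg].
- exists (fun _ _ => 0) => [v|x _]; first exact: heat_class_cst.
  exact: is_diff_cst.
- exists (fun v _ => l v) => [v|x _]; first exact: heat_class_cst.
  exact: is_diff_continuous_linear.
- exists (fun v q => tau v * (- 2^-1 * (Num.sqrt (tau q))^-1 ^+ 3)); last exact: is_diff_isqrt.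
  move=> v; apply: (heat_class_mul (heat_class_cst _)).
  apply: (heat_class_mul (heat_class_cst _)).
  by do 2 apply: (heat_class_mul heat_class_isqrt); exact: heat_class_isqrt.
- exists (fun v q => tau v * 'D_1 phi (tau q)) => [v|x Ux].
    apply: (heat_class_mul (heat_class_cst _)).
    exact: (heat_class_smooth (smooth1_on_derive sphi)).
  apply: is_diff_comp1; last exact: is_diff_continuous_linear.
  exact: (smooth1_on_is_derive sphi).
- exists (fun v q => tau v * phi' (tau q)) => [v|x Ux].
    apply: (heat_class_mul (heat_class_cst _)).
    exact: (heat_class_smooth sphi').
  by apply: is_diff_comp1; [exact: dphi|exact: is_diff_continuous_linear].
- exists (fun v q => f' v q + g' v q) => [v|x Ux]; first exact: heat_class_add.
  exact: (is_diffD (Df' _ Ux) (Dg' _ Ux)).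
- exists (fun v q => f q * g' v q + g q * f' v q) => [v|x Ux].
    by apply: heat_class_add; exact: heat_class_mul.
  exact: (is_diffM (Df' _ Ux) (Dg' _ Ux)).
- exists (fun v q => f' v q * expR (f q)) => [v|x Ux].
    by apply: heat_class_mul => //; exact: heat_class_exp.
  exact: (is_diff_comp1 (is_derive_expR _) (Df' _ Ux)).
- exists (fun v q => f' v q * moment H n.+1 (f q) (g q) +
      (- 1) * (g' v q * moment H n.+2 (f q) (g q))) => [v|x Ux].
    apply: heat_class_add; first by apply: heat_class_mul => //; exact: heat_class_moment.
    apply: (heat_class_mul (heat_class_cst _)).
    by apply: heat_class_mul => //; exact: heat_class_moment.
  have Dp := is_diff_pair (Df' _ Ux) (Dg' _ Ux).
  have Dm := is_diff_moment mH iH n (p := (f x, g x)) (gpos _ Ux).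
  apply: is_diff_eq (is_diff_comp Dp Dm) _.
  by apply/funext => v /=; rewrite mulN1r.
- exists f' => // x Ux; apply: near_eq_is_diff (Df' _ Ux).
  have := open_nbhs_nbhs (conj open_heat_domain Ux).
  by apply: filterS => y Uy; apply: fg; rewrite inE.
Qed.

Lemma heat_class_smooth_on (f : V -> R) : heat_class f -> smooth_on U f.
Proof.
by apply: smooth_on_class; [exact: open_heat_domain|exact: heat_class_diff].
Qed.

End SmoothClass.

(** * The heat equation for the heat integral *)

Section HeatEquation.
Variables (R : realType) (H : R -> R).
Local Notation leb := (@lebesgue_measure R).
Hypothesis mH : measurable_fun setT H.
Hypothesis iH : forall m : R, 0 < m ->
  leb.-integrable setT (EFin \o (fun w => expR (- (m * w ^+ 2)) * H w)).
Variable k : R.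
Hypothesis k0 : 0 < k.

(** Expanding the square in the kernel separates [s] from [w]. The inverse of [t] is written as the
    square of its inverse square root, the form available in [heat_class]. *)
Lemma heat_integralE (s t : R) : 0 < t ->
  heat_integral k H s t = (2 * Num.sqrt (pi * k))^-1 * ((Num.sqrt t)^-1 *
    (expR (- ((4 * k)^-1 * (Num.sqrt t)^-1 ^+ 2 * s ^+ 2)) *
     moment H 0 (2 * ((4 * k)^-1 * (Num.sqrt t)^-1 ^+ 2) * s)
       ((4 * k)^-1 * (Num.sqrt t)^-1 ^+ 2))).
Proof.
move=> t0; set b := (4 * k)^-1 * _.
have bE : b = (4 * k * t)^-1.
  by rewrite /b exprVn sqr_sqrtr ?ltW// -invfM.
have b0 : 0 < b by rewrite bE invr_gt0 !mulr_gt0.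
rewrite /heat_integral sqrtrM ?mulr_ge0 ?pi_ge0 ?ltW//.
rewrite (mulrA 2) invfM -(mulrA _ _ (\int[_]_w _ w)); congr (_ * (_ * _)).
rewrite /moment -RintegralZl//; last exact: integrable_moment_integrand.
apply: eq_Rintegral => w _.
rewrite /heat_integrand /moment_integrand expr0 mul1r -[(4 * k * t)^-1]bE mulrA -expRD.
rewrite (real_normK (num_real _)).
by congr (expR _ * _); ring.
Qed.

Variables (V : normedModType R) (sigma tau : {linear V -> R}).
Hypothesis csigma : continuous sigma.
Hypothesis ctau : continuous tau.
Let U : set V := [set q | 0 < tau q].
(** With [t] the time, [z] is [t] to the power -1/2 and [b] is [1 / (4 k t)]. *)
Let z (q : V) : R := (Num.sqrt (tau q))^-1.
Let b (q : V) : R := (4 * k)^-1 * z q ^+ 2.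

(** On [U] this is the heat integral of [w ^+ n * H w] at phase [sigma q] and time [tau q], with the
    kernel expanded. *)
Definition heat_moment (n : nat) (q : V) : R :=
  (2 * Num.sqrt (pi * k))^-1 * (z q * (expR (- (b q * sigma q ^+ 2)) *
    moment H n (2 * b q * sigma q) (b q))).

Let z_gt0 q : U q -> 0 < z q.
Proof. by move=> Uq; rewrite invr_gt0 sqrtr_gt0. Qed.

Let b_gt0 q : U q -> 0 < b q.
Proof. by move=> Uq; rewrite mulr_gt0 ?exprn_gt0 ?z_gt0// invr_gt0 mulr_gt0. Qed.

Let heat_class_z : heat_class H tau z.
Proof. exact: heat_class_isqrt. Qed.

Let heat_class_sigma : heat_class H tau sigma.
Proof. exact: heat_class_lin. Qed.

Let heat_class_b : heat_class H tau b.
Proof.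
apply: (heat_class_mul (heat_class_cst _ _ _)).
exact: (heat_class_mul heat_class_z heat_class_z).
Qed.

Lemma heat_class_heat_moment n : heat_class H tau (heat_moment n).
Proof.
apply: (heat_class_mul (heat_class_cst _ _ _)).
apply: (heat_class_mul heat_class_z).
apply: heat_class_mul.
  apply: heat_class_exp; apply: (@heat_class_ext _ _ _ _
      (fun q => (-1) * (b q * (sigma q * sigma q)))); last by move=> q _; ring.
  apply: (heat_class_mul (heat_class_cst _ _ _)).
  exact: (heat_class_mul heat_class_b (heat_class_mul _ _)).
apply: heat_class_moment => //.
apply: heat_class_mul => //.
exact: (heat_class_mul (heat_class_cst _ _ _)).
Qed.

Let is_diff_b q : U q -> is_diff q b (fun v => tau v * (- (b q * z q ^+ 2))).
Proof.
move=> Uq; have Dz := is_diff_isqrt ctau Uq.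
have D := is_diffM (is_diff_cst ((4 * k)^-1 : R) q) (is_diffM Dz Dz).
apply: is_diff_eq D _; apply/funext => v.
rewrite !fctE /GRing.scale /= -[(0 : V -> R) v]/(0 : R) /b /z.
by field; rewrite !gt_eqF ?sqrtr_gt0.
Qed.

(** On the kernel, [z] times the exponential of [- b (s - w)^2], the derivative in [s] brings out
    [2 b (w - s)] and that in time [b z^2 (s - w)^2 - z^2 / 2]; each power of [w] raises the order
    of the moment. *)
Lemma is_diff_heat_moment n q : U q -> is_diff q (heat_moment n)
  (fun v =>
    sigma v * (2 * b q * heat_moment n.+1 q - 2 * b q * sigma q * heat_moment n q) +
    tau v * ((b q * z q ^+ 2 * sigma q ^+ 2 - z q ^+ 2 / 2) * heat_moment n q
      - 2 * b q * z q ^+ 2 * sigma q * heat_moment n.+1 q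
      + b q * z q ^+ 2 * heat_moment n.+2 q)).
Proof.
move=> Uq; have Dz := is_diff_isqrt ctau Uq.
have Db := is_diff_b Uq.
have Ds := is_diff_continuous_linear q csigma.
have Dbs2 := is_diffN (is_diffM Db (is_diffM Ds Ds)).
have De := is_diff_comp1 (is_derive_expR _) Dbs2.
have D2bs := is_diffM (is_diffM (is_diff_cst (2 : R) q) Db) Ds.
have Dm := is_diff_comp (is_diff_pair D2bs Db)
  (is_diff_moment mH iH n (p := (2 * b q * sigma q, b q)) (b_gt0 Uq)).
have D := is_diffM (is_diff_cst ((2 * Num.sqrt (pi * k))^-1 : R) q)
  (is_diffM Dz (is_diffM De Dm)).
apply: is_diff_eq D _; apply/funext => v.
rewrite /heat_moment !fctE /GRing.scale /= -/(z q).
rewrite -[(0 : V -> R) v]/(0 : R).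
set C := (2 * Num.sqrt _)^-1; set e := expR _; set m0 := moment _ n _ _; set m1 := moment _ n.+1 _ _.
set m2 := moment _ n.+2 _ _.
by field.
Qed.

Definition heat_moment_dt (n : nat) (q : V) : R :=
  (b q * z q ^+ 2 * sigma q ^+ 2 - z q ^+ 2 / 2) * heat_moment n q
  - 2 * b q * z q ^+ 2 * sigma q * heat_moment n.+1 q
  + b q * z q ^+ 2 * heat_moment n.+2 q.

Definition heat_moment_dphase (n : nat) (q : V) : R :=
  2 * b q * heat_moment n.+1 q - 2 * b q * sigma q * heat_moment n q.

(* [sigma] is the space variable and [tau] the time, so that the coefficient
   of [sigma v] is the heat equation: the second space derivative of
   [heat_moment 0] is [k^-1] times its time derivative. *)
Lemma is_diff_heat_moment_dphase q : U q ->
  is_diff q (heat_moment_dphase 0) (fun v =>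
    sigma v * (k^-1 * heat_moment_dt 0 q) +
    tau v * (2 * b q * heat_moment_dt 1 q
      - 2 * b q * z q ^+ 2 * heat_moment 1 q
      + 2 * b q * z q ^+ 2 * sigma q * heat_moment 0 q
      - 2 * b q * sigma q * heat_moment_dt 0 q)).
Proof.
move=> Uq; have Db := is_diff_b Uq.
have Ds := is_diff_continuous_linear q csigma.
have D2b := is_diffM (is_diff_cst (2 : R) q) Db.
have D := is_diffB (is_diffM D2b (is_diff_heat_moment 1 Uq))
  (is_diffM (is_diffM D2b Ds) (is_diff_heat_moment 0 Uq)).
apply: is_diff_eq D _; apply/funext => v.
rewrite /heat_moment_dt !fctE /GRing.scale /= -[(0 : V -> R) v]/(0 : R).
set g0 := heat_moment 0 q; set g1 := heat_moment 1 q.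
set g2 := heat_moment 2 q; set g3 := heat_moment 3 q.
(* The relation [z q ^+ 2 = 4 * k * b q], visible once [b] is unfolded, equates the coefficients. *)
rewrite /b; field.
by rewrite gt_eqF.
Qed.

End HeatEquation.

(** * The limit of the heat integral at time zero *)

Section InitialValue.
Variables (R : realType) (H : R -> R) (k : R).
Local Notation leb := (@lebesgue_measure R).
Hypothesis k0 : 0 < k.

(** The heat kernel is the normal density of mean [s] and variance [2 * k * t], which supplies its
    integrability and total mass 1. *)
Lemma normal_pdf_heat_kernel (s t w : R) : 0 < t ->
  normal_pdf s (Num.sqrt (2 * k * t)) w =
  (2 * Num.sqrt (pi * k * t))^-1 * expR (- (`|s - w| ^+ 2 / (4 * k * t))).
Proof.
move=> t0; have kt0 : 0 < 2 * k * t by rewrite !mulr_gt0.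
rewrite normal_pdfE ?gt_eqF ?sqrtr_gt0//.
rewrite /normal_peak /normal_fun sqr_sqrtr ?ltW// (real_normK (num_real _)).
congr (_^-1 * expR _); last first.
  by rewrite -(opprB w s) sqrrN mulNr -mulr_natr; congr (- (_ / _)); ring.
have -> : 2 * k * t * pi *+ 2 = 2 ^+ 2 * (pi * k * t) by rewrite -mulr_natr; ring.
by rewrite sqrtrM ?sqr_ge0// sqrtr_sqr ger0_norm.
Qed.

(** With [r] the squared distance to the centre, this bounds the kernel at time [t] by the one at
    time 1, up to a factor that vanishes with [t]. *)
Lemma heat_kernel_tail (r d t : R) : 0 < d -> d <= r -> 0 < t -> t <= 2^-1 ->
  (Num.sqrt t)^-1 * expR (- (r / (4 * k * t))) <=
  8 * k / d * Num.sqrt t * expR (- (r / (4 * k))).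
Proof.
move=> d0 dr t0 t2.
have st0 : 0 < Num.sqrt t by rewrite sqrtr_gt0.
(* [r / (4 k t) = r / (4 k) + x], and [exp (- x) <= x^-1 <= 8 k t / d] pays for
   the factor [(sqrt t)^-1]. *)
set x := r / (4 * k) * (t^-1 - 1).
have -> : - (r / (4 * k * t)) = - (r / (4 * k)) + - x by rewrite /x; field; rewrite !gt_eqF.
rewrite expRD mulrCA [leRHS]mulrC ler_wpM2l ?expR_ge0//.
(* [t <= 1/2] gives [t^-1 - 1 >= t^-1 / 2]. *)
have xd : d / (8 * k * t) <= x.
  rewrite /x (_ : d / _ = d / (4 * k) * (t^-1 / 2)); last by field; rewrite !gt_eqF.
  apply: ler_pM.
  - by rewrite divr_ge0// ltW// mulr_gt0.
  - by rewrite divr_ge0// invr_ge0 ltW.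
  - by rewrite ler_pM2r// invr_gt0 mulr_gt0.
  - have : 2 <= t^-1 by rewrite -[2]invrK lef_pV2 ?posrE ?invr_gt0.
    lra.
have x0 : 0 < d / (8 * k * t) by rewrite divr_gt0// !mulr_gt0.
have : expR (- x) <= (d / (8 * k * t))^-1.
  rewrite expRN lef_pV2 ?posrE ?expR_gt0//.
  by have := expR_ge1Dx x; lra.
move=> ex; rewrite -(ler_pM2l st0) mulrA mulfV ?gt_eqF// mul1r.
apply: (le_trans ex); rewrite invf_div.
rewrite [leRHS](_ : _ = 8 * k / d * (Num.sqrt t ^+ 2)); last by ring.
rewrite sqr_sqrtr; last exact: ltW.
by rewrite le_eqVlt; apply/orP; left; apply/eqP; ring.
Qed.

Hypothesis iH : forall s t : R, 0 < t ->
  leb.-integrable setT (fun w => (heat_integrand k H s t w)%:E).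

(** The kernel is an approximate identity. Within distance [d] of [s] continuity of [H] suffices;
    the rest contributes at most [C * M * sqrt t], even for unbounded [H]. *)
Lemma heat_integral_cvg (s : R) : {for s, continuous H} ->
  heat_integral k H s t @[t --> 0^'+] --> H s.
Proof.
move=> cH; pose K t w := normal_pdf s (Num.sqrt (2 * k * t)) w.
have iK t : leb.-integrable setT (EFin \o K t) by exact: integrable_normal_pdf.
have KE t w : 0 < t -> K t w * H w = (2 * Num.sqrt (pi * k * t))^-1 * heat_integrand k H s t w.
  by move=> t0; rewrite /K normal_pdf_heat_kernel// /heat_integrand mulrA.
have Z (c : R) (f : R -> R) : leb.-integrable setT (EFin \o f) ->
    leb.-integrable setT (EFin \o (fun w => c * f w)).
  move=> If; have := integrableZl measurableT c If.
  by under eq_fun do rewrite /= -EFinM.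
have iKH t : 0 < t -> leb.-integrable setT (EFin \o (fun w => K t w * H w)).
  move=> t0; have := Z (2 * Num.sqrt (pi * k * t))^-1 _ (iH s t0).
  by apply: eq_integrable => // w _; rewrite /= KE.
(* Away from [s] the kernel at time [t] is at most [C * sqrt t] times the
   kernel at time [1], so [C * sqrt t * E] dominates there. *)
pose E (w : R) : R := `|K 1 w * H w| + `|H s| * K 1 w.
have iE : leb.-integrable setT (EFin \o E).
  have := integrableD measurableT (integrable_norm (iKH 1 ltr01)) (Z `|H s| _ (iK 1)).
  by [].
have E0 w : 0 <= E w by rewrite addr_ge0// mulr_ge0// normal_pdf_ge0.
pose M := \int[leb]_w E w.
have M0 : 0 <= M by apply: Rintegral_ge0 => w _.
apply/cvgrPdist_le => e e0.
have e20 : 0 < e / 2 by lra.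
have /cvgrPdist_le/(_ _ e20)/nbhs_ballP[d /= d0 Hd] := cH.
have d20 : 0 < d ^+ 2 by rewrite exprn_gt0.
pose C := 8 * k / d ^+ 2.
have C0 : 0 < C by rewrite divr_gt0// mulr_gt0.
near=> t.
have t0 : 0 < t by [].
have t2 : t <= 2^-1 by near: t; apply: nbhs_right_le; rewrite invr_gt0.
have tM : C * M * Num.sqrt t <= e / 2.
  have : t <= (e / 2 / (C * M + 1)) ^+ 2.
    near: t; apply: nbhs_right_le; rewrite exprn_gt0// divr_gt0//.
    by rewrite ltr_wpDl// mulr_ge0// ltW.
  have CM : 0 < C * M + 1 by rewrite ltr_wpDl// mulr_ge0// ltW.
  rewrite -ler_sqrt ?sqr_ge0// sqrtr_sqr ger0_norm; last by rewrite divr_ge0 ?ltW.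
  rewrite ler_pdivlMr// => h; have := sqrtr_ge0 t; lra.
(* Total mass 1 writes [H s] as an integral against the same kernel, so the error is a single
   integral of [K t w * (H s - H w)]. *)
have IKs : \int[leb]_w (K t w * H s) = H s.
  rewrite RintegralZr//.
  by rewrite /Rintegral integral_normal_pdf mul1r.
have -> : heat_integral k H s t = \int[leb]_w (K t w * H w).
  rewrite /heat_integral -RintegralZl//; last exact: iH.
  by apply: eq_Rintegral => w _; rewrite KE.
have iKs : leb.-integrable setT (EFin \o (fun w => K t w * H s)).
  by under eq_fun do rewrite mulrC; exact: Z.
have iD : leb.-integrable setT (EFin \o (fun w => K t w * H s - K t w * H w)).
  by have := integrableB measurableT iKs (iKH _ t0).
rewrite -{1}IKs -RintegralB//; last exact: iKH.
apply: (le_trans (le_normr_Rintegral measurableT iD)).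
have iB : leb.-integrable setT (EFin \o (fun w => (e / 2) * K t w + (C * Num.sqrt t) * E w)).
  by have := integrableD measurableT (Z (e / 2) _ (iK t)) (Z (C * Num.sqrt t) _ iE).
apply: (@le_trans _ _ (\int[leb]_w ((e / 2) * K t w + (C * Num.sqrt t) * E w))).
  apply: le_Rintegral => //; first exact: integrable_norm.
  move=> w _; rewrite -mulrBr normrM ger0_norm ?normal_pdf_ge0//.
  have K0 : 0 <= K t w by exact: normal_pdf_ge0.
  have [wd|wd] := ltrP `|s - w| d.
    have Hw : `|H s - H w| <= e / 2 by apply: Hd; rewrite -ball_normE.
    rewrite mulrC (le_trans (ler_wpM2r K0 Hw))// lerDl.
    by rewrite mulr_ge0// mulr_ge0 ?sqrtr_ge0// ltW.
  apply: (@le_trans _ _ ((C * Num.sqrt t) * E w)); last first.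
    by rewrite lerDr mulr_ge0// ltW.
  have KK : K t w <= C * Num.sqrt t * K 1 w.
    rewrite /K !normal_pdf_heat_kernel// !mulr1.
    have dr : d ^+ 2 <= `|s - w| ^+ 2 by rewrite lerXn2r ?nnegrE// ltW.
    have tail := heat_kernel_tail d20 dr t0 t2.
    have pk0 : 0 <= pi * k by rewrite mulr_ge0 ?pi_ge0// ltW.
    rewrite (sqrtrM _ pk0) (mulrA 2) invfM -(mulrA _ (Num.sqrt t)^-1) [leRHS]mulrCA.
    by rewrite ler_wpM2l// invr_ge0 mulr_ge0 ?sqrtr_ge0.
  apply: (le_trans (ler_wpM2r (normr_ge0 _) KK)).
  have Ct0 : 0 <= C * Num.sqrt t by rewrite mulr_ge0 ?sqrtr_ge0// ltW.
  rewrite -(mulrA (C * Num.sqrt t)) ler_wpM2l//.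
  have K10 : 0 <= K 1 w by exact: normal_pdf_ge0.
  rewrite /E normrM (ger0_norm K10) (mulrC `|H s|) -mulrDr ler_wpM2l//.
  by rewrite (le_trans (ler_normB _ _))// addrC.
rewrite RintegralD//; [|by apply: Z; exact: iK|exact: Z].
rewrite !RintegralZl//.
have -> : \int[leb]_w K t w = 1 by rewrite /Rintegral integral_normal_pdf.
rewrite mulr1 -/M; move: tM.
rewrite mulrAC => tM; lra.
Unshelve. all: by end_near.
Qed.

End InitialValue.

(** * Shear flows solving the Navier-Stokes system *)

Section ShearFlow.
Variable R : realType.
Local Notation V := ('rV[R]_3 * R)%type.

Lemma sum_ord3 (f : 'I_3 -> R) : \sum_(j < 3) f j = f 0 + f 1 + f 2.
Proof.
rewrite !big_ord_recl big_ord0 addr0 addrA.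
by congr (f _ + f _ + f _); apply/val_inj.
Qed.

Lemma phase_is_linear (c1 c2 : R) : linear (fun q : V => phase c1 c2 q.1).
Proof. by move=> c u v; rewrite /phase /GRing.scale /= !mxE; ring. Qed.

Definition phase_linear (c1 c2 : R) : {linear V -> R} :=
  HB.pack (fun q : V => phase c1 c2 q.1)
    (GRing.isLinear.Build _ _ _ _ _ (@phase_is_linear c1 c2)).

Lemma time_is_linear : linear (fun q : V => q.2).
Proof. by []. Qed.

Definition time_linear : {linear V -> R} :=
  HB.pack (fun q : V => q.2) (GRing.isLinear.Build _ _ _ _ _ time_is_linear).

Lemma coord_is_linear (i : 'I_3) : linear (fun q : V => q.1 0 i).
Proof. by move=> c u v; rewrite !mxE. Qed.

Definition coord_linear (i : 'I_3) : {linear V -> R} :=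
  HB.pack (fun q : V => q.1 0 i)
    (GRing.isLinear.Build _ _ _ _ _ (@coord_is_linear i)).

Lemma continuous_time_linear : continuous time_linear.
Proof. by move=> q; exact: cvg_snd. Qed.

Lemma continuous_coord_linear i : continuous (coord_linear i).
Proof.
move=> q; apply: (@cvg_comp _ _ _ (fun q : V => q.1) (fun x : 'rV[R]_3 => x 0 i)).
  exact: cvg_fst.
exact: coord_continuous.
Qed.

Lemma continuous_phase_linear c1 c2 : continuous (phase_linear c1 c2).
Proof.
move=> q; rewrite /phase_linear /= /phase.
by apply: cvgB; [apply: cvgB|]; (apply: cvgM; [exact: cvg_cst|exact: continuous_coord_linear]).
Qed.

Lemma open_positive_time : open (@positive_time R).
Proof. exact: (open_heat_domain continuous_time_linear). Qed.

(** A directional derivative only sees the line through [x] along [v]. This allows the time to be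
    frozen when the pressure is differentiated in space. *)
Lemma eq_is_derive (W : normedModType R) (f g : W -> R) (x v : W) (d : R) :
  (forall h, f (h *: v + x) = g (h *: v + x)) ->
  is_derive x v g d -> is_derive x v f d.
Proof.
move=> fg [gd gD].
have E : (fun h => h^-1 *: ((f \o shift x) (h *: v) - f x)) =
    (fun h => h^-1 *: ((g \o shift x) (h *: v) - g x)).
  apply/funext => h /=; rewrite fg; congr (_ *: (_ - _)).
  by have := fg 0; rewrite scale0r add0r.
by split; rewrite /derivable /derive E.
Qed.

Lemma is_diff_is_derive (W : normedModType R) (f df : W -> R) (x v : W) :
  is_diff x f df -> is_derive x v f (df v).
Proof.
move=> D; apply: DeriveDef; first exact/diff_derivable/ex_diff.
by rewrite deriveE ?diff_val//; exact: ex_diff.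
Qed.

(** Separates the varying part, of fixed direction [(1, c1, c2)], from the constant part. *)
Lemma vec3_affine (y c1 c2 d1 d2 : R) :
  vec3 y (c1 * y + d1) (c2 * y + d2) = y *: vec3 1 c1 c2 + vec3 0 d1 d2.
Proof.
apply/rowP; case=> [[|[|[|//]]] i3]; rewrite !mxE /=; ring.
Qed.

Lemma dirx_phase c1 c2 j :
  phase c1 c2 (@dirx R j).1 = [:: 2 * c1 * c2; - c2; - c1]`_j.
Proof.
rewrite /phase /dirx /= !mxE.
by case: j => [[|[|[|//]]] i3] /=; ring.
Qed.

(* The flow moves along planes on which [phase] is constant, so its advection
   term vanishes. *)
Lemma shear_flow (mu c1 c2 d1 d2 : R) (a : R -> R) (h1 : 'rV[R]_3 -> R)
    (u1 us uss ut ust p : V -> R) :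
  d1 * c2 + c1 * d2 = 0 ->
  (forall q, positive_time q ->
     is_diff q u1 (fun v => phase c1 c2 v.1 * us q + v.2 * ut q)) ->
  (forall q, positive_time q ->
     is_diff q us (fun v => phase c1 c2 v.1 * uss q + v.2 * ust q)) ->
  (forall q j, positive_time q ->
     is_derive q (dirx R j) p (a q.2 * [:: 1; c1; c2]`_j)) ->
  (forall q, positive_time q -> ut q + a q.2 =
     mu * (4 * c1 ^+ 2 * c2 ^+ 2 + c1 ^+ 2 + c2 ^+ 2) * uss q) ->
  (forall x, u1 (x, t) @[t --> 0^'+] --> h1 x) ->
  NS_solution mu (fun x => vec3 (h1 x) (c1 * h1 x + d1) (c2 * h1 x + d2))
    (fun q => vec3 (u1 q) (c1 * u1 q + d1) (c2 * u1 q + d2)) p.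
Proof.
move=> dc Du1 Dus Dp heat lim0; set u := fun q : V => vec3 _ _ _.
(* [e] is the direction of the varying part, [f] the constant part and [l] the gradient of the
   phase. *)
pose e (i : 'I_3) : R := [:: 1; c1; c2]`_i.
pose f (i : 'I_3) : R := [:: 0; d1; d2]`_i.
pose l (i : 'I_3) : R := [:: 2 * c1 * c2; - c2; - c1]`_i.
have compE i : Defs.comp u i = (fun q => e i * u1 q + f i).
  by apply/funext => q; rewrite /Defs.comp /u vec3_affine !mxE mulrC.
have Dcomp i q : positive_time q ->
    is_diff q (Defs.comp u i) (fun v => e i * (phase c1 c2 v.1 * us q + v.2 * ut q)).
  move=> Uq; rewrite compE.
  have D := is_diffD (is_diffM (is_diff_cst (e i : R) q) (Du1 _ Uq)) (is_diff_cst (f i : R) q).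
  apply: is_diff_eq D _; apply/funext => v.
  rewrite !fctE /GRing.scale /= -[(0 : V -> R) v]/(0 : R); ring.
have Dx i j q : positive_time q -> is_derive q (dirx R j) (Defs.comp u i) (e i * l j * us q).
  move=> Uq; apply: is_derive_eq (is_diff_is_derive (dirx R j) (Dcomp i q Uq)) _.
  by rewrite dirx_phase /= -/(l j); ring.
have Dt i q : positive_time q -> is_derive q (dirt R) (Defs.comp u i) (e i * ut q).
  move=> Uq; apply: is_derive_eq (is_diff_is_derive (dirt R) (Dcomp i q Uq)) _.
  by rewrite /phase /= !mxE; ring.
have dxE i j q : positive_time q -> dx j (Defs.comp u i) q = e i * l j * us q.
  by move=> Uq; rewrite /dx; have [_ ->] := Dx i j q Uq.
have Dxx i j q : positive_time q ->
    is_derive q (dirx R j) (dx j (Defs.comp u i)) (e i * l j ^+ 2 * uss q).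
  move=> Uq.
  have D := is_diffM (is_diff_cst (e i * l j : R) q) (Dus _ Uq).
  have D' := is_diff_is_derive (dirx R j) D.
  (* [dxE] holds only at positive times, an open set, so the first derivative is replaced near
     [q]. *)
  apply: (@near_eq_is_derive _ _ _ (cst (e i * l j) * us)).
    have := open_nbhs_nbhs (conj open_positive_time Uq).
    by apply: filterS => y Uy; rewrite dxE.
  apply: is_derive_eq D' _.
  rewrite !fctE /GRing.scale /= -[(0 : V -> R) _]/(0 : R).
  rewrite -[phase _ _ _]/(phase c1 c2 (dirx R j).1) dirx_phase -/(l j); ring.
split.
- move=> q Uq; split; [|split] => [i|i j|j].
  + by have [] := Dt i q Uq.
  + by split; [have [] := Dx i j q Uq|have [] := Dxx i j q Uq].
  + by have [] := Dp q j Uq.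
- move=> q Uq i.
  have -> : advection u i q = 0.
    rewrite /advection sum_ord3 !dxE// !compE /e /f /l /=.
    (* The contribution of [e] cancels because [e] is orthogonal to [l]; the scalar product of [f]
       and [l] remains and is zero by [dc]. *)
    rewrite [LHS](_ : _ = - (d1 * c2 + c1 * d2) * [:: 1; c1; c2]`_i * us q); last by ring.
    by rewrite dc oppr0 !mul0r.
  rewrite /laplacian sum_ord3 /dt /dx.
  have [_ ->] := Dt i q Uq; have [_ ->] := Dp q i Uq.
  have [_ ->] := Dxx i 0 q Uq; have [_ ->] := Dxx i 1 q Uq.
  have [_ ->] := Dxx i 2 q Uq.
  (* The squares of the components of [l] add up to the factor of [mu] in [heat]. *)
  rewrite -/(e i) /l /= (_ : ut q = mu * (4 * c1 ^+ 2 * c2 ^+ 2 + c1 ^+ 2 + c2 ^+ 2)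
    * uss q - a q.2); last by rewrite -heat// addrK.
  by ring.
- move=> q Uq; rewrite /divergence sum_ord3 !dxE// /e /l /=; ring.
- move=> x; rewrite vec3_affine /u.
  under eq_cvg do rewrite vec3_affine.
  by apply: cvgD; [apply: cvgZr_tmp|exact: cvg_cst].
Qed.

End ShearFlow.

(** * The shear flow driven by the heat integral *)

Section HeatShearFlow.
Variable R : realType.
Local Notation V := ('rV[R]_3 * R)%type.
Local Notation leb := (@lebesgue_measure R).
Variables (mu c1 c2 d1 d2 : R) (H : R -> R).
Let mu' := mu * (4 * c1 ^+ 2 * c2 ^+ 2 + c1 ^+ 2 + c2 ^+ 2).
Let h1 := fun x : 'rV[R]_3 => H (phase c1 c2 x).
Hypothesis mu_gt0 : 0 < mu.
Hypothesis orth : d1 * c2 + c1 * d2 = 0.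
Hypothesis smoothH : smooth1_on setT H.
Hypothesis iH : forall s t : R, 0 < t ->
  leb.-integrable setT (fun w => (heat_integrand mu' H s t w)%:E).
Hypothesis c_neq0 : (c1, c2) <> (0, 0).

Let mu'_gt0 : 0 < mu'.
Proof.
apply: mulr_gt0 => //.
have h12 : 0 <= c1 ^+ 2 * c2 ^+ 2 by rewrite mulr_ge0 ?sqr_ge0.
have c1_ge0 := sqr_ge0 c1; have c2_ge0 := sqr_ge0 c2.
have [c10|c10] := eqVneq c1 0.
  have [c20|c20] := eqVneq c2 0; first by case: c_neq0; rewrite c10 c20.
  have : 0 < c2 ^+ 2 by rewrite exprn_even_gt0.
  lra.
have : 0 < c1 ^+ 2 by rewrite exprn_even_gt0.
lra.
Qed.

Let mH : measurable_fun setT H.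
Proof. by apply: continuous_measurable_fun; exact: smooth1_on_continuous. Qed.

(** At [s = 0] and time [1 / (4 mu' m)] the heat integrand is exactly this Gaussian weight times
    [H]. *)
Let iG (m : R) : 0 < m ->
  leb.-integrable setT (EFin \o (fun w => expR (- (m * w ^+ 2)) * H w)).
Proof.
move=> m0; have t0 : 0 < (4 * mu' * m)^-1 by rewrite invr_gt0; apply: mulr_gt0 => //; exact: mulr_gt0.
have := iH 0 t0; apply: eq_integrable => // w _ /=.
rewrite /heat_integrand sub0r normrN (real_normK (num_real w)).
congr (expR (- _) * _)%:E; field.
by rewrite !gt_eqF.
Qed.

Variables a b A : R -> R.
Hypothesis dA : forall t : R, 0 < t -> is_derive t 1 A (a t).
Hypothesis A0 : A 0 = 0.
Hypothesis cA : A t @[t --> 0^'+] --> A 0.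

Let u1 (q : V) : R := heat_integral mu' H (phase c1 c2 q.1) q.2 - A q.2.
Let u (q : V) := vec3 (u1 q) (c1 * u1 q + d1) (c2 * u1 q + d2).
Let p (q : V) : R := a q.2 * (q.1 0 0 + c1 * q.1 0 1 + c2 * q.1 0 2) + b q.2.
Let sigma : {linear V -> R} := phase_linear c1 c2.
Let tau : {linear V -> R} := time_linear R.
Let csigma : continuous sigma := @continuous_phase_linear R c1 c2.
Let ctau : continuous tau := @continuous_time_linear R.
Let G (n : nat) (q : V) : R := heat_moment H mu' sigma tau n q.

Let u1E q : positive_time q -> u1 q = G 0 q - A q.2.
Proof. by move=> Uq; rewrite /u1 (heat_integralE mH iG). Qed.

Let is_diff_u1 q : positive_time q -> is_diff q u1 (fun v =>
  phase c1 c2 v.1 * heat_moment_dphase H mu' sigma tau 0 q +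
  v.2 * (heat_moment_dt H mu' sigma tau 0 q - a q.2)).
Proof.
move=> Uq; apply: (@near_eq_is_diff _ _ (G 0 - (A \o tau))).
  have := open_nbhs_nbhs (conj (@open_positive_time R) Uq).
  by apply: filterS => y Uy; rewrite u1E.
have DA := is_diff_comp1 (dA Uq) (is_diff_continuous_linear q ctau).
have DG := is_diff_heat_moment mH iG mu'_gt0 csigma ctau 0 Uq.
apply: is_diff_eq (is_diffB DG DA) _; apply/funext => v.
have distr (s x t y : R) : s + x * t - x * y = s + x * (t - y) by ring.
exact: distr.
Qed.

Lemma NS_heat_shear_flow : NS_solution mu
  (fun x => vec3 (h1 x) (c1 * h1 x + d1) (c2 * h1 x + d2)) u p.
Proof.
apply: (shear_flow (a := a) orth is_diff_u1).
- move=> q Uq.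
  exact: (is_diff_heat_moment_dphase mH iG mu'_gt0 csigma ctau Uq).
- move=> q j Uq.
  (* Along a space direction the time stays [q.2], so [a] and [b] enter as constants. *)
  apply: (@eq_is_derive _ _ _ (fun y : V => a q.2 * (coord_linear R 0 y +
    c1 * coord_linear R 1 y + c2 * coord_linear R 2 y) + b q.2)).
    by move=> h; rewrite /p /dirx /= scaler0 add0r.
  have Dx i := is_diff_continuous_linear q (@continuous_coord_linear R i).
  have D := is_diffD (is_diffM (is_diff_cst (a q.2) q)
    (is_diffD (is_diffD (Dx 0) (is_diffM (is_diff_cst c1 q) (Dx 1)))
      (is_diffM (is_diff_cst c2 q) (Dx 2)))) (is_diff_cst (b q.2) q).
  apply: is_derive_eq (is_diff_is_derive (dirx R j) D) _.
  rewrite !fctE /GRing.scale /= -[(0 : V -> R) _]/(0 : R) !mxE.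
  by case: j => [[|[|[|//]]] i3] /=; ring.
(* The time coefficient plus [a] is [heat_moment_dt], and [mu'] cancels its inverse in the second
   phase derivative. *)
- by move=> q Uq; rewrite subrK mulVKf ?gt_eqF.
- move=> x; rewrite /u1 -[h1 x]subr0 -[X in _ - X]A0; apply: cvgB; last exact: cA.
  exact: (heat_integral_cvg mu'_gt0 iH (smooth1_on_continuous smoothH (x := phase c1 c2 x))).
Qed.

Lemma smooth_heat_shear_velocity :
  smooth1_on [set t | 0 < t] a -> smooth_velocity u.
Proof.
move=> sa i; apply: (heat_class_smooth_on mH iG ctau).
apply: (@heat_class_ext _ _ _ _ (fun q => [:: 1; c1; c2]`_i *
    (G 0 q + (-1) * A (tau q)) + [:: 0; d1; d2]`_i)); last first.
  move=> q; rewrite inE => Uq.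
  by rewrite /Defs.comp /u vec3_affine !mxE (u1E Uq) mulrC mulN1r.
apply: heat_class_add; last exact: heat_class_cst.
apply: heat_class_mul; first exact: heat_class_cst.
apply: heat_class_add; first exact: heat_class_heat_moment.
apply: heat_class_mul; first exact: heat_class_cst.
exact: (heat_class_primitive _ _ dA sa).
Qed.

Lemma smooth_heat_shear_pressure : smooth1_on [set t | 0 < t] a ->
  smooth1_on [set t | 0 < t] b -> smooth_pressure p.
Proof.
move=> sa sb; apply: (heat_class_smooth_on mH iG ctau).
apply: heat_class_add; last exact: (heat_class_smooth _ _ sb).
apply: heat_class_mul; first exact: (heat_class_smooth _ _ sa).
have X i : heat_class H tau (coord_linear R i).
  exact/heat_class_lin/continuous_coord_linear.
have cX (c : R) i : heat_class H tau (fun q : V => c * q.1 0 i).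
  exact: (heat_class_mul (heat_class_cst _ _ c) (X i)).
exact: (heat_class_add (heat_class_add (X 0) (cX c1 1)) (cX c2 2)).
Qed.

End HeatShearFlow.

(** * Existence, including the case of a constant phase *)

Lemma smooth_on_cst (R : realType) (W : normedModType R) (c : R) (U : set W) :
  open U -> smooth_on U (fun _ : W => c).
Proof.
move=> oU; apply: (@smooth_on_class _ _ _ (fun f => exists c, f = cst c)) => //; last by exists c.
move=> _ [d ->]; exists (fun _ _ => 0); first by exists 0.
by move=> x _; exact: is_diff_cst.
Qed.

Theorem propositionB1 (R : realType) (mu c1 c2 d1 d2 : R) (H : R -> R) :
  let mu' := mu * (4 * c1 ^+ 2 * c2 ^+ 2 + c1 ^+ 2 + c2 ^+ 2) in
  let h1 := fun x : 'rV[R]_3 => H (phase c1 c2 x) in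
  let h := fun x : 'rV[R]_3 => vec3 (h1 x) (c1 * h1 x + d1) (c2 * h1 x + d2) in
  let g := heat_integral mu' H in
  0 < mu ->
  d1 * c2 + c1 * d2 = 0 ->
  smooth1_on setT H ->
  ((c1, c2) <> (0, 0) -> forall s t : R, 0 < t ->
     (@lebesgue_measure R).-integrable setT
       (fun w => (heat_integrand mu' H s t w)%:E)) ->
  (exists (u : 'rV[R]_3 * R -> 'rV[R]_3) (p : 'rV[R]_3 * R -> R),
     [/\ NS_solution mu h u p, smooth_velocity u & smooth_pressure p]) /\
  ((c1, c2) <> (0, 0) -> forall a b A : R -> R,
     (forall t : R, 0 < t -> is_derive t 1 A (a t)) ->
     A 0 = 0 ->
     A t @[t --> 0^'+] --> A 0 ->
     let u1 := fun q : 'rV[R]_3 * R => g (phase c1 c2 q.1) q.2 - A q.2 in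
     let u := fun q : 'rV[R]_3 * R =>
       vec3 (u1 q) (c1 * u1 q + d1) (c2 * u1 q + d2) in
     let p := fun q : 'rV[R]_3 * R =>
       a q.2 * (q.1 0 0 + c1 * q.1 0 1 + c2 * q.1 0 2) + b q.2 in
     [/\ NS_solution mu h u p,
         smooth1_on [set t | 0 < t] a -> smooth_velocity u &
         smooth1_on [set t | 0 < t] a -> smooth1_on [set t | 0 < t] b ->
         smooth_pressure p]).
Proof.
move=> mu' h1 h g mu0 dc sH iH; split; last first.
  move=> c0 a b A dA A0 cA u1 u p; have iH' := iH c0; split.
  - exact: NS_heat_shear_flow.
  - by move=> sa; apply: (smooth_heat_shear_velocity d1 d2 mu0 sH iH' c0 dA).
  - by move=> sa sb; apply: (smooth_heat_shear_pressure mu0 sH iH' c0).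
have [c00|/eqP c0] := eqVneq (c1, c2) (0, 0).
  (* Here [mu'] is 0 and the heat kernel degenerates, but the phase is identically 0, so the initial
     velocity is constant and stays a solution. *)
  move: c00 => [c10 c20].
  pose U0 (_ : 'rV[R]_3 * R) := H 0.
  exists (fun q => vec3 (U0 q) (c1 * U0 q + d1) (c2 * U0 q + d2)), (fun _ => 0); split.
  - apply: (@shear_flow _ _ _ _ _ _ (fun _ => 0) h1 U0 (fun _ => 0) (fun _ => 0)
      (fun _ => 0) (fun _ => 0)) => //.
    + move=> q _; apply: is_diff_eq (is_diff_cst (H 0) q) _.
      by apply/funext => v; rewrite !mulr0 addr0.
    + move=> q _; apply: is_diff_eq (is_diff_cst (0 : R) q) _.
      by apply/funext => v; rewrite !mulr0 addr0.
    + by move=> q j _; rewrite mul0r; exact: is_derive_cst.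
    + by move=> q _; rewrite !(mulr0, addr0).
    + move=> x; rewrite /h1 /phase c10 c20 !(mulr0, mul0r, subr0).
      exact: cvg_cst.
  - move=> i; rewrite (_ : Defs.comp _ i =
        fun _ => H 0 * [:: 1; c1; c2]`_i + [:: 0; d1; d2]`_i).
      by apply: smooth_on_cst; exact: open_positive_time.
    by apply/funext => q; rewrite /Defs.comp vec3_affine !mxE.
  - by apply: smooth_on_cst; exact: open_positive_time.
have iH' := iH c0.
(* The choice [a = b = A = 0] in the explicit family gives the required solution. *)
pose z (_ : R) : R := 0.
have dz (t : R) : 0 < t -> is_derive t 1 z (z t) by move=> _; exact: is_derive_cst.
have sz : smooth1_on [set t : R | 0 < t] z by apply: smooth_on_cst; exact: open_gt.
have cz : z t @[t --> 0^'+] --> z 0 by exact: cvg_cst.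
exists (fun q : 'rV[R]_3 * R => let u1 := g (phase c1 c2 q.1) q.2 - z q.2 in
  vec3 u1 (c1 * u1 + d1) (c2 * u1 + d2)),
  (fun q : 'rV[R]_3 * R => z q.2 * (q.1 0 0 + c1 * q.1 0 1 + c2 * q.1 0 2) + z q.2).
split.
- by apply: (NS_heat_shear_flow mu0 dc sH iH' c0 z dz _ cz).
- by apply: (smooth_heat_shear_velocity d1 d2 mu0 sH iH' c0 dz sz).
- by apply: (smooth_heat_shear_pressure mu0 sH iH' c0 sz sz).
Qed.
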